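(* Let $E,F\in\mathbb C^{n\times m}$, let $\lambda\in\mathbb C$ be an eigenvalue of the matrix pencil $P(s)=sE-F$, and denote by $w(\lambda)=(w_k(\lambda))$, $a=(a_k)$, $b=(b_k)$ the corresponding sequences of the Weyr characteristic $(w,a,b,c)$ of $P$. Let $Q(s)$ be another matrix pencil in $\mathbb C^{n\times m}$ such that $\operatorname{rank}(P-Q)=1$, and denote by $\widetilde w(\lambda)=(\widetilde w_k(\lambda))$, $\widetilde a=(\widetilde a_k)$, $\widetilde b=(\widetilde b_k)$ the corresponding sequences of the Weyr characteristic $(\widetilde w,\widetilde a,\widetilde b,\widetilde c)$ of $Q$. (a) If $(Q-P)(s)=p\,(su^*-v^* )$ with $u,v\in\mathbb C^m$, $(u,v)\neq(0,0)$, and $p\in\mathbb C^n$, $p\ne0$, then for each $k\ge1$ $$|(w_k(\lambda)+b_k)-(\widetilde w_k(\lambda)+\widetilde b_k)|\le k,\qquad |(a_k+b_k)-(\widetilde a_k+\widetilde b_k)|\le k.$$ (b) If $(Q-P)(s)=(su-v)\,p^*$ with $u,v\in\mathbb C^n$, $(u,v)\ne(0,0)$, and $p\in\mathbb C^m$, $p\neq0$, then for each $k\ge1$ $$|(w_k(\lambda)+b_{k+1})-(\widetilde w_k(\lambda)+\widetilde b_{k+1})|\le k,\qquad |(a_k+b_{k+1})-(\widetilde a_k+\widetilde b_{k+1})|\le k.$$ (c) If $P$ and $Q$ are regular, then for each $k\ge1$ one has $b_k=\widetilde b_k=0$ and $$|w_k(\lambda)-\widetilde w_k(\lambda)|\le1,\qquad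 |a_k-\widetilde a_k|\le1,$$ independently of the form of the rank one pencil $Q-P$.
   Context: A matrix pencil in $\mathbb C^{n\times m}$ is $P(s)=sE-F$ with $E,F\in\mathbb C^{n\times m}$. It is regular if $n=m$ and $\det P(s)$ is not identically zero. $\operatorname{rank}(P)$ is the normal rank, i.e. the largest size of a regular square submatrix pencil of $P$. A number $\lambda\in\mathbb C$ is a (finite) eigenvalue of $P$ if the rank of the matrix $P(\lambda)$ is less than $\operatorname{rank}(P)$. **Weyr characteristic of a pencil.** For $k\ge1$ let $N_k\in\mathbb C^{k\times k}$ have ones on the first subdiagonal and zeros elsewhere, and let $K_k=[I_{k-1}\ 0]$, $L_k=[0\ I_{k-1}]\in\mathbb C^{(k-1)\times k}$ (for $k=1$ these are $0\times1$ matrices, contributing just a zero column to a block diagonal matrix, and their transposes contribute just a zero row). For a multi-index $\alpha=(\alpha_1,\dots,\alpha_l)$ of positive integers, $|\alpha|=\sum_i\alpha_i$ and $N_\alpha,K_\alpha,L_\alpha$ are the block diagonal matrices with blocks $N_{\alpha_i},K_{\alpha_i},L_{\alpha_i}$. Every pencil $sE-F$ with $E,F\in\mathbb C^{n\times m}$ admits invertible $V\in\mathbb C^{n\times n}$, $U\in\mathbb C^{m\times m}$ with $$V(sE-F)U=\operatorname{diag}\big(sI_{n_0}-J_0,\ sN_\alpha-I_{|\alpha|},\ sK_\beta-L_\beta,\ sK_\gamma^\top-L_\gamma^\top\big)$$ (Kronecker canonical form), where $J_0$ is in Jordan normal form and $\alpha,\beta,\gamma$ are non-increasing multi-indices (any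 block may be absent), unique up to permutation of the Jordan blocks of $J_0$. The Weyr characteristic $(w,a,b,c)$ is: $w$ is the collection, indexed by the eigenvalues $\lambda$ of $J_0$ (which are the finite eigenvalues of the pencil), of the sequences $w(\lambda)=(w_k(\lambda))_k$, $w_k(\lambda)=\dim\ker((J_0-\lambda)^k)-\dim\ker((J_0-\lambda)^{k-1})$; $a,b,c$ are the conjugate partitions of $\alpha,\beta,\gamma$, i.e. $a_k=\#\{i:\alpha_i\ge k\}$, and similarly for $b,c$. All sequences are extended by zeros for all $k\ge1$; if $\lambda$ is not an eigenvalue of $Q$, then $\widetilde w_k(\lambda)=0$ for all $k$. *)

(* Defs.v *)
From mathcomp Require Import all_boot all_order all_algebra.

Set Implicit Arguments.
Unset Strict Implicit.
Unset Printing Implicit Defensive.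

Import Order.TTheory GRing.Theory Num.Theory.
Local Open Scope ring_scope.

Section Pencils.
Variable F : fieldType.

(* s A - B, with s the polynomial indeterminate *)
Definition pencil n m (A B : 'M[F]_(n, m)) : 'M[{poly F}]_(n, m) :=
  'X *: map_mx polyC A - map_mx polyC B.

(* [conform_mx 0 P] is [P] itself when [n = m]. *)
Definition regular n m (P : 'M[{poly F}]_(n, m)) : bool :=
  (n == m) && (\det (conform_mx (0 : 'M_n) P) != 0).

Definition increasing r n (f : 'I_r -> 'I_n) : bool :=
  [forall i : 'I_r, forall j : 'I_r, (i < j)%N ==> (f i < f j)%N].

(* Submatrices are selected by increasing lists of row and column indices;
   the empty submatrix is regular, so the zero pencil has rank 0. *)
Definition normal_rank n m (P : 'M[{poly F}]_(n, m)) : nat :=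
  \max_(r < (minn n m).+1 |
        [exists f : {ffun 'I_r -> 'I_n}, exists g : {ffun 'I_r -> 'I_m},
           [&& increasing f, increasing g & regular (mxsub f g P)]]) r.

Definition pencil_eigenvalue n m (P : 'M[{poly F}]_(n, m)) (lambda : F) : bool :=
  (\rank (map_mx (horner_eval lambda) P) < normal_rank P)%N.

Definition dsum n1 m1 n2 m2 (R : nmodType)
    (A : 'M[R]_(n1, m1)) (B : 'M[R]_(n2, m2)) : 'M[R]_(n1 + n2, m1 + m2) :=
  block_mx A 0 0 B.

(* Block diagonal matrix with rectangular blocks [B x], for [x] in [s]; blocks
   without rows (or columns) contribute only zero columns (or rows). *)
Fixpoint diag_blocks (T : Type) (r c : T -> nat) (B : forall x, 'M[F]_(r x, c x))
    (s : seq T) : 'M[F]_(sumn (map r s), sumn (map c s)) :=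
  match s return 'M[F]_(sumn (map r s), sumn (map c s)) with
  | [::] => 0
  | x :: s' => dsum (B x) (diag_blocks B s')
  end.

Definition N_block k : 'M[F]_k := \matrix_(i, j) ((i == j.+1 :> nat)%:R).
Definition K_block k : 'M[F]_(k.-1, k) := \matrix_(i, j) ((i == j :> nat)%:R).
Definition L_block k : 'M[F]_(k.-1, k) := \matrix_(i, j) ((i.+1 == j :> nat)%:R).

Definition N_mx (alpha : seq nat) := diag_blocks N_block alpha.
Definition K_mx (beta : seq nat) := diag_blocks K_block beta.
Definition L_mx (beta : seq nat) := diag_blocks L_block beta.

(* Upper triangular Jordan block with eigenvalue [x.1] and size [x.2] *)
Definition jordan_block (x : F * nat) : 'M[F]_(x.2) :=
  x.1%:M + (N_block x.2)^T.

Definition jordan_mx (J : seq (F * nat)) := diag_blocks jordan_block J.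

Definition kronecker_pencil (J : seq (F * nat)) (alpha beta gamma : seq nat) :=
  dsum (pencil 1%:M (jordan_mx J))
    (dsum (pencil (N_mx alpha) 1%:M)
       (dsum (pencil (K_mx beta) (L_mx beta))
             (pencil (K_mx gamma)^T (L_mx gamma)^T))).

Definition is_multi_index (alpha : seq nat) : bool :=
  all (leq 1) alpha && sorted geq alpha.

(* The Kronecker canonical form of [P] has the Jordan blocks [J] and the
   multi-indices [alpha], [beta], [gamma]. *)
Definition kronecker_form n m (P : 'M[{poly F}]_(n, m))
    (J : seq (F * nat)) (alpha beta gamma : seq nat) : Prop :=
  [/\ all (fun x : F * nat => (0 < x.2)%N) J,
      is_multi_index alpha, is_multi_index beta, is_multi_index gamma
    & exists (V : 'M[F]_n) (U : 'M[F]_m) dims,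
        [/\ V \in unitmx, U \in unitmx &
          map_mx polyC V *m P *m map_mx polyC U =
          castmx dims (kronecker_pencil J alpha beta gamma)]].

(* Dimension of the kernel of [A] acting on column vectors; [kermx] is the
   kernel for the action on row vectors. *)
Definition dim_ker n m (A : 'M[F]_(n, m)) : nat := \rank (kermx A^T).

(* For k >= 1 the subtraction does not truncate; the value is 0 when [lambda]
   is not an eigenvalue of [A]. *)
Definition weyr_mx n (A : 'M[F]_n) (lambda : F) (k : nat) : nat :=
  (dim_ker ((A - lambda%:M) ^+ k) - dim_ker ((A - lambda%:M) ^+ k.-1))%N.

Definition conjugate_partition (alpha : seq nat) (k : nat) : nat :=
  count (leq k) alpha.

(* Sequences are indexed by k >= 1; their values at 0 are irrelevant. Over an
   algebraically closed field every pencil has a Kronecker canonical form,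
   unique up to the order of [J], so that [w], [a], [b], [c] exist and are
   unique for k >= 1. *)
Definition weyr_characteristic n m (P : 'M[{poly F}]_(n, m))
    (w : F -> nat -> nat) (a b c : nat -> nat) : Prop :=
  exists (J : seq (F * nat)) (alpha beta gamma : seq nat),
    kronecker_form P J alpha beta gamma /\
    forall k, (1 <= k)%N ->
      [/\ forall lambda, w lambda k = weyr_mx (jordan_mx J) lambda k,
          a k = conjugate_partition alpha k,
          b k = conjugate_partition beta k
        & c k = conjugate_partition gamma k].

End Pencils.

(* Main.v *)
Require Import Defs.
From mathcomp Require Import all_boot all_order all_algebra.
From mathcomp Require Import boolp.
From mathcomp Require Import complex reals.
From mathcomp Require Import zify.

Set Implicit Arguments.
Unset Strict Implicit.
Unset Printing Implicit Defensive.

Import Order.TTheory GRing.Theory Num.Theory.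
Local Open Scope ring_scope.
Local Open Scope sesquilinear_scope.

(** Two linear relations are attached to the pencil sE - F, namely
    A = E^-1 F = {(x, y) | F x = E y} on C^m and B = F E^-1 = {(E x, F x)} on
    C^n.  The k-th power of A has as kernel the endpoints x_(k-1) of the chains
    F x_0 = 0, F x_(i+1) = E x_i, and ker B^k = E (ker A^k).  In the Kronecker
    canonical form, a Jordan block of size j for the eigenvalue 0 contributes
    min(k, j) to dim ker A^k and to dim ker B^k, a block K_j contributes
    min(k, j) to the first and min(k+1, j) - 1 to the second, and the other
    blocks contribute nothing.  So the increments of the two dimensions from
    k-1 to k are w_k + b_k and w_k + b_(k+1).  Replacing F by F - lambda E
    gives all of w(lambda), and exchanging E and F gives the sequence a.

    A perturbation p (s u^* - v^* ) changes A, and a perturbation (su - v) p^*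
    changes B, only off a common subrelation D whose codimension is at most 1
    in both relations.  It remains to compare the kernels of powers of such a
    pair of relations, A and A', through D.

    Lemma [codim1_relker_sub]: ker A^(k+1) is contained in
    ker D^(k+1) + ker A^k + <x> for one vector x.  Chains behave as polynomials
    in a shift variable: an A-chain x that leaves D as early as possible can be
    used, with shifts and multiples, to cancel one after another the edges of
    another chain that leave D; only its unshifted multiple can have an
    endpoint outside ker A^k.  Hence the increments of dim ker A^k exceed those
    of dim ker D^k by at most 1, and dim ker A^k <= dim ker D^k + k.

    In the other direction, ker D^(k+1) / ker D^k maps to
    ker A'^(k+1) / ker A'^k with kernel
    (ker D^(k+1) meet ker A'^k) / ker D^k, of dimension at most k.  The two
    estimates add up to 1 + k, the bound of (a) and (b) with index k + 1.  If
    A' has no singular chain, that is, no nontrivial chain from 0 to 0, a chain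
    is determined by its endpoint, so that this kernel vanishes and the bound
    becomes 1.

    For (c), a pencil of rank one has vanishing 2 x 2 minors; since its entries
    have degree at most 1, they factor as a constant vector times a vector
    pencil, on one side or on the other ([rank_one_pencil]).  A regular pencil
    has an invertible value at some l; the dimension formula at l then shows
    that beta is empty, whence b = 0, and that there are no singular chains.

    Matrices act on row vectors below, so that e and f stand for the transposes
    of E and F. *)

(** * Kernels of powers of linear relations *)

Section Relations.
Variables (F : fieldType) (d : nat).

(** The kernel of the k-th power of the linear relation formed by the pairs
    (x, y) with [row_mx x y] in the row space of [A]. *)
Fixpoint relker t (A : 'M[F]_(t, d + d)) (k : nat) : 'M[F]_d :=
  if k is k'.+1 then
    <<(A :&: block_mx 1%:M 0 0 (relker A k'))%MS *m col_mx 1%:M 0>>%MS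
  else 0.

(** Only the values [x 0], ..., [x k] matter; [x k] is called the endpoint. *)
Definition is_chain t (A : 'M[F]_(t, d + d)) (k : nat) (x : nat -> 'rV[F]_d) :=
  x 0%N = 0 /\ forall i, (i < k)%N -> (row_mx (x i.+1) (x i) <= A)%MS.

Lemma sub_diag_mx m1 m2 n1 n2 (u : 'rV[F]_n1) (v : 'rV[F]_n2)
    (A : 'M[F]_(m1, n1)) (B : 'M[F]_(m2, n2)) :
  (row_mx u v <= block_mx A 0 0 B)%MS = (u <= A)%MS && (v <= B)%MS.
Proof.
apply/idP/andP => [/submxP[w]|[/submxP[a ->] /submxP[b ->]]].
  rewrite -[w]hsubmxK mul_row_block !mulmx0 addr0 add0r => /eq_row_mx[-> ->].
  by rewrite !submxMl.
apply/submxP; exists (row_mx a b).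
by rewrite mul_row_block !mulmx0 addr0 add0r.
Qed.

Lemma relkerSP t (A : 'M[F]_(t, d + d)) k (v : 'rV_d) :
  (v <= relker A k.+1)%MS <->
  exists2 y : 'rV_d, (row_mx v y <= A)%MS & (y <= relker A k)%MS.
Proof.
rewrite /= genmxE; split.
  case/submxP=> w ->; rewrite mulmxA.
  have := submxMl w (A :&: block_mx 1%:M 0 0 (relker A k))%MS.
  set e := w *m _; rewrite sub_capmx -[e]hsubmxK sub_diag_mx.
  move=> /andP[eA /andP[_ eN]].
  by exists (rsubmx e); rewrite // mul_row_col mulmx1 mulmx0 addr0.
case=> y vA yN; have -> : v = row_mx v y *m col_mx 1%:M 0.
  by rewrite mul_row_col mulmx1 mulmx0 addr0.
by rewrite submxMr // sub_capmx vA sub_diag_mx submx1.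
Qed.

Lemma relkerP t (A : 'M[F]_(t, d + d)) k (v : 'rV_d) :
  (v <= relker A k)%MS <-> exists2 x, is_chain A k x & x k = v.
Proof.
elim: k v => [|k IH] v.
  split=> [|[x [x0 _] <-]]; last by rewrite x0 sub0mx.
  by rewrite submx0 => /eqP->; exists (fun=> 0).
rewrite relkerSP; split=> [[y vA /IH[x [x0 xA] xk]]|[x [x0 xA] <-]].
  exists (fun i => if i == k.+1 then v else x i); last by rewrite eqxx.
  split=> // i; rewrite ltnS leq_eqVlt eqSS => /predU1P[->|ik].
    by rewrite eqxx (ltn_eqF (ltnSn k)) xk.
  by rewrite !ltn_eqF ?xA // ltnS ltnW.
exists (x k); first exact: xA.
by apply/IH; exists x => //; split=> // i ik; apply: xA; rewrite ltnS ltnW.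
Qed.

Lemma relkerS t (A : 'M[F]_(t, d + d)) k : (relker A k <= relker A k.+1)%MS.
Proof.
elim: k => [|k IH]; first exact: sub0mx.
apply/rV_subP => v /relkerSP[y vA yN]; apply/relkerSP.
by exists y => //; apply: submx_trans IH.
Qed.

Lemma relker_le t (A : 'M[F]_(t, d + d)) j k :
  (j <= k)%N -> (relker A j <= relker A k)%MS.
Proof.
move=> /subnK <-; elim: (k - j)%N => //= r IH.
exact: submx_trans IH (relkerS _ _).
Qed.

Lemma relker_mono t1 t2 (D : 'M[F]_(t1, d + d)) (A : 'M[F]_(t2, d + d)) k :
  (D <= A)%MS -> (relker D k <= relker A k)%MS.
Proof.
move=> DA; apply/rV_subP => v /relkerP[x [x0 xD] <-]; apply/relkerP.
by exists x => //; split=> // i /xD/submx_trans; apply.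
Qed.

Section Codim1.
Variables (t1 t2 : nat) (D : 'M[F]_(t1, d + d)) (A : 'M[F]_(t2, d + d)).
Hypothesis DA : (D <= A)%MS.
Hypothesis rAD : (\rank A <= (\rank D).+1)%N.

(** The subrelation D + <e> is strictly larger than D, hence all of A. *)
Lemma codim1_combine (e e' : 'rV_(d + d)) :
  (e <= A)%MS -> ~~ (e <= D)%MS -> (e' <= A)%MS ->
  exists c, (e' - c *: e <= D)%MS.
Proof.
move=> eA eD e'A.
have sA : (D + e <= A)%MS by rewrite addsmx_sub DA.
have DDe : (D < D + e)%MS.
  by rewrite /ltmx addsmxSl /= addsmx_sub submx_refl.
have : (A <= D + e)%MS.
  by rewrite -(geq_leqif (mxrank_leqif_sup sA)) (leq_trans rAD) ?rank_ltmx.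
move/(submx_trans e'A)/sub_addsmxP => [[a b] /= ->].
have [c ->] : exists c : F, b = c%:M by exists (b 0 0); exact: mx11_scalar.
by exists c; rewrite mul_scalar_mx addrK submxMl.
Qed.

(** Among the A-chains of length k + 1, one which leaves D after the least
    number j of edges provides the vector: by the choice of j every chain has
    its first j edges in D, and every later edge outside D can be cancelled with
    a multiple of a shift of this chain.  A proper shift ends in
    [relker A k]. *)
Lemma codim1_relker_sub k :
  exists x : 'rV_d, (relker A k.+1 <= relker D k.+1 + relker A k + x)%MS.
Proof.
pose escapes j := exists2 x, is_chain A k.+1 x &
  (j < k.+1)%N /\ ~~ (row_mx (x j.+1) (x j) <= D)%MS.
have [esc|noesc] := pselect (exists j, `[< escapes j >]); last first.
  exists 0; apply: submx_trans (submx_trans (addsmxSl _ _) (addsmxSl _ _)).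
  apply/rV_subP => v /relkerP[x xA <-].
  apply/relkerP; exists x => //; split=> [|i ik]; first by case: xA.
  by apply/negPn/negP => xD; apply: noesc; exists i; apply/asboolP; exists x.
case: (ex_minnP esc) => j /asboolP[x xA [jk xj]] jmin.
have inD y i : is_chain A k.+1 y -> (i < j)%N ->
    (row_mx (y i.+1) (y i) <= D)%MS.
  move=> yA ij; apply/negPn/negP => yD.
  have /asboolP/jmin : escapes i by exists y => //; split=> //; lia.
  by rewrite leqNgt ij.
exists (x k.+1); set S := (_ + _ + _)%MS.
(* [l] counts the edges of [y] known to be in [D], [r] those left to treat. *)
suff reduce r l y : (l + r)%N = k.+1 -> (j <= l)%N -> is_chain A k.+1 y ->
    (forall i, (i < l)%N -> (row_mx (y i.+1) (y i) <= D)%MS) ->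
    (y k.+1 <= S)%MS.
  apply/rV_subP => v /relkerP[y yA <-].
  apply: (reduce (k.+1 - j)%N j) => //; first lia.
  by move=> i ij; exact: inD.
elim: r l y => [|r IH] l y lr jl yA yD.
  apply: submx_trans (submx_trans (addsmxSl _ _) (addsmxSl _ _)).
  apply/relkerP; exists y => //; split=> [|i ik]; first by case: yA.
  by apply: yD; lia.
have [c cD] : exists c, (row_mx (y l.+1) (y l) -
    c *: row_mx (x j.+1) (x j) <= D)%MS.
  apply: codim1_combine => //; first by apply: (proj2 xA); lia.
  by apply: (proj2 yA); lia.
(* The shift of [x] by [l - j] steps has its first edge outside [D] at [l]; the
   truncated subtraction pads it with the root [x 0 = 0]. *)
pose z i := x (i - (l - j))%N.
have zedge i : row_mx (z i.+1) (z i) =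
    if (i < l - j)%N then 0
    else row_mx (x (i - (l - j)).+1) (x (i - (l - j))%N).
  rewrite /z; case: ltnP => il; last by rewrite subSn.
  have [-> ->] : (i.+1 - (l - j) = 0 /\ i - (l - j) = 0)%N by lia.
  by rewrite (proj1 xA) row_mx0.
pose y' i := y i - c *: z i.
have y'edge i : row_mx (y' i.+1) (y' i) =
    row_mx (y i.+1) (y i) - c *: row_mx (z i.+1) (z i).
  by rewrite scale_row_mx opp_row_mx add_row_mx.
have y'A : is_chain A k.+1 y'.
  split=> [|i ik].
    by rewrite /y' /z (proj1 yA) sub0n (proj1 xA) scaler0 subr0.
  rewrite y'edge addmx_sub ?(proj2 yA) // eqmx_opp scalemx_sub //.
  rewrite zedge; case: ifP => _; first exact: sub0mx.
  by apply: (proj2 xA); lia.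
have y'D i : (i < l.+1)%N -> (row_mx (y' i.+1) (y' i) <= D)%MS.
  rewrite ltnS leq_eqVlt y'edge zedge => /predU1P[->|il].
    have -> : (l < l - j)%N = false by lia.
    by have -> : (l - (l - j))%N = j by lia.
  rewrite addmx_sub ?yD // eqmx_opp scalemx_sub //.
  case: ifP => ilj; first exact: sub0mx.
  by apply: inD => //; lia.
have -> : y k.+1 = y' k.+1 + c *: z k.+1 by rewrite subrK.
rewrite addmx_sub //.
  by apply: (IH l.+1) => //; [lia | exact: leqW].
apply: scalemx_sub; rewrite /z; have [lj|lj] := eqVneq l j.
  by rewrite lj subnn subn0 addsmxSr.
apply: submx_trans (submx_trans (addsmxSr _ _) (addsmxSl _ _)).
apply: (submx_trans (B := relker A (k.+1 - (l - j)))).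
  apply/relkerP; exists x => //; split=> [|i ik]; first by case: xA.
  by apply: (proj2 xA); lia.
by apply: relker_le; lia.
Qed.

(** Division of the preceding inclusion by [relker A k]: the increments of the
    kernel dimensions of A exceed those of D by at most 1. *)
Lemma codim1_relker_rank k :
  (\rank (relker A k.+1) + \rank (relker D k) <=
   \rank (relker D k.+1) + \rank (relker A k) + 1)%N.
Proof.
have [x /mxrankS sub] := codim1_relker_sub k.
have le1 := (mxrank_adds_leqif (relker D k.+1 + relker A k)%MS x).1.
have le2 := rank_leq_row x.
have eq3 := mxrank_sum_cap (relker D k.+1) (relker A k).
have : (relker D k <= relker D k.+1 :&: relker A k)%MS.
  by rewrite sub_capmx relkerS relker_mono.
move/mxrankS; lia.
Qed.

Lemma codim1_relker_rank_le k :
  (\rank (relker A k) <= \rank (relker D k) + k)%N.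
Proof.
elim: k => [|k IH]; first by rewrite /= mxrank0.
have := codim1_relker_rank k; lia.
Qed.

End Codim1.

(** A singular chain is a nontrivial chain that ends at 0.  Here its last edge
    joins z to 0; if that edge is trivial, the same condition applies to
    the chain that remains. *)
Definition no_singular_chain t (B : 'M[F]_(t, d + d)) :=
  forall k (z : 'rV_d), (row_mx 0 z <= B)%MS -> (z <= relker B k)%MS -> z = 0.

Section Perturbation.
Variables (t1 t2 : nat) (A : 'M[F]_(t1, d + d)) (B : 'M[F]_(t2, d + d)).
Hypothesis rA : (\rank A <= (\rank (A :&: B)%MS).+1)%N.

(** Without singular chains, two B-chains with the same endpoint coincide.  A
    vector in ker D^(k+1) and in ker B^k then has a D-chain whose first edge is
    trivial, so it lies in ker D^k. *)
Lemma relker_perturb_regular k : no_singular_chain B ->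
  (\rank (relker A k.+1) + \rank (relker B k) <=
   \rank (relker B k.+1) + \rank (relker A k) + 1)%N.
Proof.
move=> regB; have := codim1_relker_rank (capmxSl A B) rA k.
set D := (A :&: B)%MS.
have := mxrank_sum_cap (relker D k.+1) (relker B k).
have : (relker D k.+1 + relker B k <= relker B k.+1)%MS.
  by rewrite addsmx_sub relkerS relker_mono ?capmxSr.
move/mxrankS.
have : (relker D k.+1 :&: relker B k <= relker D k)%MS.
  elim: k => [|k IH]; first exact: capmxSr.
  apply/rV_subP => v; rewrite sub_capmx => /andP[].
  move=> /relkerSP[y vD yD] /relkerSP[y' vB y'B].
  apply/relkerSP; exists y => //.
  apply: submx_trans IH; rewrite sub_capmx yD /=.
  (* [0, y - y'] would be the last edge of a singular chain. *)
  suff /eqP : y - y' = 0 by rewrite subr_eq0 => /eqP ->.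
  apply: (regB k.+1).
    have -> : row_mx 0 (y - y') = row_mx v y - row_mx v y'.
      by rewrite opp_row_mx add_row_mx subrr.
    by rewrite addmx_sub ?eqmx_opp // (submx_trans vD) ?capmxSr.
  rewrite addmx_sub ?eqmx_opp //; last exact: submx_trans (relkerS _ _).
  by apply: submx_trans yD _; rewrite relker_mono ?capmxSr.
move/mxrankS; lia.
Qed.

Hypothesis rB : (\rank B <= (\rank (A :&: B)%MS).+1)%N.

(** The increment for A exceeds that for the common subrelation D by at most 1.
    The increment for D exceeds that for B by at most the dimension of
    (ker D^(k+1) meet ker B^k) / ker D^k, and dim ker B^k - dim ker D^k <= k. *)
Lemma relker_perturb k :
  (\rank (relker A k.+1) + \rank (relker B k) <=
   \rank (relker B k.+1) + \rank (relker A k) + k.+1)%N.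
Proof.
have := codim1_relker_rank (capmxSl A B) rA k.
have := codim1_relker_rank_le (capmxSr A B) rB k.
set D := (A :&: B)%MS.
have := mxrank_sum_cap (relker D k.+1) (relker B k).
have : (relker D k.+1 + relker B k <= relker B k.+1)%MS.
  by rewrite addsmx_sub relkerS relker_mono ?capmxSr.
move/mxrankS.
have := mxrankS (capmxSr (relker D k.+1) (relker B k)).
lia.
Qed.

End Perturbation.
End Relations.

(** * The linear relations of a pencil *)

Section Chains.
Variable F : fieldType.

(** Endpoints of the chains x_1 f = 0, x_(i+1) f = x_i e of length k, that is,
    the kernel of the k-th power of the relation x f = y e. *)
Fixpoint chainker m n (e f : 'M[F]_(m, n)) (k : nat) : 'M[F]_m :=
  if k is k'.+1 then kermx (f *m cokermx (chainker e f k' *m e)) else 0.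

Lemma chainkerSE m n (e f : 'M[F]_(m, n)) k p (v : 'M_(p, m)) :
  (v <= chainker e f k.+1)%MS = (v *m f <= chainker e f k *m e)%MS.
Proof. by rewrite sub_kermx mulmxA -submxE. Qed.

Lemma chainkerS m n (e f : 'M[F]_(m, n)) k :
  (chainker e f k <= chainker e f k.+1)%MS.
Proof.
elim: k => [|k IH]; first exact: sub0mx.
rewrite chainkerSE; apply: submx_trans (submxMr e IH).
by rewrite -chainkerSE.
Qed.

Lemma chainker_le m n (e f : 'M[F]_(m, n)) j k :
  (j <= k)%N -> (chainker e f j <= chainker e f k)%MS.
Proof.
move=> /subnK <-; elim: (k - j)%N => //= r IH.
exact: submx_trans IH (chainkerS _ _ _).
Qed.

Definition kerrel m n (e f : 'M[F]_(m, n)) := kermx (col_mx f (- e)).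
Definition imrel m n (e f : 'M[F]_(m, n)) := row_mx e f.

Lemma sub_kerrel m n (e f : 'M[F]_(m, n)) p (x y : 'M_(p, m)) :
  (row_mx x y <= kerrel e f)%MS = (x *m f == y *m e).
Proof. by rewrite sub_kermx mul_row_col mulmxN subr_eq0. Qed.

Lemma relker_kerrel m n (e f : 'M[F]_(m, n)) k :
  (relker (kerrel e f) k :=: chainker e f k)%MS.
Proof.
elim: k => [|k IH] //; apply/eqmxP/rV_eqP => v.
rewrite chainkerSE; apply/idP/idP => [/relkerSP[y]|/submxP[w wE]].
  by rewrite sub_kerrel IH => /eqP-> yN; exact: submxMr.
apply/relkerSP; exists (w *m chainker e f k).
  by rewrite sub_kerrel wE mulmxA.
by rewrite IH submxMl.
Qed.

Lemma relker_imrel m n (e f : 'M[F]_(m, n)) k :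
  (relker (imrel e f) k :=: chainker e f k *m e)%MS.
Proof.
elim: k => [|k IH]; first by apply/eqmxP; rewrite mul0mx !sub0mx.
apply/eqmxP/rV_eqP => v; apply/idP/idP.
  move=> /relkerSP[y /submxP[w]]; rewrite mul_mx_row IH.
  by move=> /eq_row_mx[-> ->] wN; rewrite submxMr // chainkerSE.
case/submxP=> w ->; apply/relkerSP.
exists (w *m chainker e f k.+1 *m f).
  by rewrite mulmxA -mul_mx_row submxMl.
by rewrite IH -chainkerSE submxMl.
Qed.

(** The pairs (x, y) with x v = y u satisfy both relations or none; this is
    one linear condition. *)
Lemma kerrel_perturb m n (e f : 'M[F]_(m, n)) (u v : 'cV_m) (p : 'rV_n) :
  (\rank (kerrel e f) <=
   (\rank (kerrel e f :&: kerrel (e + u *m p) (f + v *m p))%MS).+1)%N.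
Proof.
have := mxrank_mul_ker (kerrel e f) (col_mx v (- u)).
rewrite -/(kerrel u v).
have := rank_leq_col (kerrel e f *m col_mx v (- u)).
suff /mxrankS : (kerrel e f :&: kerrel u v <=
   kerrel e f :&: kerrel (e + u *m p) (f + v *m p))%MS by lia.
rewrite sub_capmx capmxSl /=; apply/rV_subP => w.
rewrite -[w]hsubmxK sub_capmx !sub_kerrel.
by case/andP=> /eqP fe /eqP vu; rewrite !mulmxDr !mulmxA fe vu.
Qed.

(** The vectors x with x p = 0 give the same pair (x e, x f) before and after
    the perturbation. *)
Lemma imrel_perturb m n (e f : 'M[F]_(m, n)) (u v : 'rV_n) (p : 'cV_m) :
  (\rank (imrel e f) <=
   (\rank (imrel e f :&: imrel (e + p *m u) (f + p *m v))%MS).+1)%N.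
Proof.
have := mxrank_mul_min (kermx p) (imrel e f).
rewrite mxrank_ker; have := rank_leq_col p; have := rank_leq_row p.
suff /mxrankS : (kermx p *m imrel e f <=
   imrel e f :&: imrel (e + p *m u) (f + p *m v))%MS by lia.
rewrite sub_capmx submxMl /=.
have -> : kermx p *m imrel e f = kermx p *m imrel (e + p *m u) (f + p *m v).
  by rewrite !mul_mx_row !mulmxDr !mulmxA mulmx_ker !mul0mx !addr0.
exact: submxMl.
Qed.

(** The rank condition says that no nonzero endpoint is annihilated by [e], and
    such an endpoint is what a singular chain would provide. *)
Lemma kerrel_no_singular m n (e f : 'M[F]_(m, n)) :
  (forall k, \rank (chainker e f k *m e) = \rank (chainker e f k)) ->
  no_singular_chain (kerrel e f).
Proof.
move=> re k z; rewrite sub_kerrel relker_kerrel mul0mx eq_sym => /eqP ze zk.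
have : (z <= chainker e f k :&: kermx e)%MS.
  by rewrite sub_capmx zk; apply/sub_kermxP.
have := mxrank_mul_ker (chainker e f k) e; rewrite re.
move/eqP; rewrite -[X in _ == X]addn0 eqn_add2l mxrank_eq0 => /eqP->.
by rewrite submx0 => /eqP.
Qed.

Lemma imrel_no_singular m n (e f : 'M[F]_(m, n)) :
  (forall k, \rank (chainker e f k *m e) = \rank (chainker e f k)) ->
  no_singular_chain (imrel e f).
Proof.
move=> re k z /submxP[w]; rewrite mul_mx_row relker_imrel.
move=> /eq_row_mx[we ->]; rewrite -chainkerSE => wk.
suff -> : w = 0 by rewrite mul0mx.
apply: (kerrel_no_singular re (k := k.+1)); last by rewrite relker_kerrel.
by rewrite sub_kerrel mul0mx -we.
Qed.

(** Strict equivalence of pencils transports chains by the matrix [a]. *)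
Lemma chainker_equiv m n (e f : 'M[F]_(m, n)) (a : 'M_m) (b : 'M_n) k :
  a \in unitmx -> b \in unitmx ->
  (chainker (a *m e *m b) (a *m f *m b) k *m a :=: chainker e f k)%MS.
Proof.
move=> ua ub; set K := chainker _ _.
suff mem j p (v : 'M_(p, m)) : (v <= K j)%MS = (v *m a <= chainker e f j)%MS.
  apply/eqmxP; rewrite -mem submx_refl /=.
  rewrite -[chainker e f k in X in (X <= _)%MS](mulmxKV ua).
  by rewrite submxMr // mem mulmxKV.
elim: j p v => [|j IH] p v.
  by rewrite !submx0 -(inj_eq (can_inj (mulmxK ua))) mul0mx.
have eqK : (K j *m a :=: chainker e f j)%MS.
  apply/eqmxP; rewrite -IH submx_refl /=.
  rewrite -[chainker e f j in X in (X <= _)%MS](mulmxKV ua).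
  by rewrite submxMr // IH mulmxKV.
rewrite !chainkerSE !mulmxA submxMfree ?row_free_unit //.
by rewrite (eqmxMr e eqK).
Qed.

Lemma rank_chainker_equiv m n (e f : 'M[F]_(m, n)) (a : 'M_m) (b : 'M_n) k :
  a \in unitmx -> b \in unitmx ->
  \rank (chainker (a *m e *m b) (a *m f *m b) k) = \rank (chainker e f k).
Proof.
move=> ua ub; rewrite -(chainker_equiv e f k ua ub).
by rewrite mxrankMfree ?row_free_unit.
Qed.

Lemma rank_chainkerM_equiv m n (e f : 'M[F]_(m, n)) (a : 'M_m) (b : 'M_n) k :
  a \in unitmx -> b \in unitmx ->
  \rank (chainker (a *m e *m b) (a *m f *m b) k *m (a *m e *m b)) =
  \rank (chainker e f k *m e).
Proof.
move=> ua ub; rewrite !mulmxA mxrankMfree ?row_free_unit //.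
by rewrite (eqmxMr e (chainker_equiv e f k ua ub)).
Qed.

Lemma mul_dsum m1 n1 p1 m2 n2 p2 (a1 : 'M[F]_(m1, n1)) (b1 : 'M_(n1, p1))
  (a2 : 'M[F]_(m2, n2)) (b2 : 'M_(n2, p2)) :
  dsum a1 a2 *m dsum b1 b2 = dsum (a1 *m b1) (a2 *m b2).
Proof. by rewrite mulmx_block !mulmx0 !mul0mx !addr0 !add0r. Qed.

Lemma tr_dsum m1 n1 m2 n2 (a1 : 'M[F]_(m1, n1)) (a2 : 'M[F]_(m2, n2)) :
  (dsum a1 a2)^T = dsum a1^T a2^T.
Proof. by rewrite tr_block_mx !trmx0. Qed.

Lemma dsum_lincomb (R : ringType) m1 n1 m2 n2 (c : R) (a1 b1 : 'M[R]_(m1, n1))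
    (a2 b2 : 'M[R]_(m2, n2)) :
  dsum a1 a2 - c *: dsum b1 b2 = dsum (a1 - c *: b1) (a2 - c *: b2).
Proof.
by rewrite scale_block_mx opp_block_mx add_block_mx !scaler0 !subr0.
Qed.

Lemma chainker_dsum m1 n1 m2 n2 (e1 f1 : 'M[F]_(m1, n1))
    (e2 f2 : 'M[F]_(m2, n2)) k :
  (chainker (dsum e1 e2) (dsum f1 f2) k :=:
   dsum (chainker e1 f1 k) (chainker e2 f2 k))%MS.
Proof.
elim: k => [|k IH]; first by rewrite /= /dsum block_mx0; exact: eqmx_refl.
apply/eqmxP/rV_eqP => v; rewrite -[v]hsubmxK sub_diag_mx !chainkerSE.
rewrite mul_row_block !mulmx0 addr0 add0r (eqmxMr _ IH).
by rewrite mul_dsum sub_diag_mx.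
Qed.

Lemma rank_chainker_dsum m1 n1 m2 n2 (e1 f1 : 'M[F]_(m1, n1))
    (e2 f2 : 'M[F]_(m2, n2)) k :
  \rank (chainker (dsum e1 e2) (dsum f1 f2) k) =
  (\rank (chainker e1 f1 k) + \rank (chainker e2 f2 k))%N.
Proof. by rewrite chainker_dsum rank_diag_block_mx. Qed.

Lemma rank_chainkerM_dsum m1 n1 m2 n2 (e1 f1 : 'M[F]_(m1, n1))
    (e2 f2 : 'M[F]_(m2, n2)) k :
  \rank (chainker (dsum e1 e2) (dsum f1 f2) k *m dsum e1 e2) =
  (\rank (chainker e1 f1 k *m e1) + \rank (chainker e2 f2 k *m e2))%N.
Proof.
by rewrite (eqmxMr _ (chainker_dsum _ _ _ _ _)) mul_dsum rank_diag_block_mx.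
Qed.

(** No chain can leave 0 when [f] is injective.  This disposes of the blocks at
    infinity and of the blocks K^T, L^T. *)
Lemma chainker_free m n (e f : 'M[F]_(m, n)) k :
  row_free f -> chainker e f k = 0.
Proof.
move=> ff; apply/eqP; rewrite -submx0; elim: k => [|k IH]; first exact: sub0mx.
rewrite -(submxMfree _ _ ff) mul0mx.
have : (chainker e f k.+1 *m f <= chainker e f k *m e)%MS.
  by rewrite -chainkerSE.
by move/submx_trans; apply; rewrite -(mul0mx _ e) submxMr.
Qed.

Lemma tr_exprmx n (g : 'M[F]_n) k : (g ^+ k)^T = g^T ^+ k.
Proof.
elim: k => [|k IH]; first by rewrite !expr0 trmx1.
by rewrite exprSr exprS -mulmxE trmx_mul IH.
Qed.

Lemma rank_chainker1 n (g : 'M[F]_n) k :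
  \rank (chainker 1%:M g^T k) = dim_ker (g ^+ k).
Proof.
rewrite /dim_ker; suff -> : (chainker 1%:M g^T k :=: kermx (g ^+ k)^T)%MS by [].
rewrite tr_exprmx; elim: k => [|k IH].
  by apply/eqmxP; rewrite sub0mx -[kermx _]mulmx1 mulmx_ker sub0mx.
apply/eqmxP/rV_eqP => v.
by rewrite chainkerSE mulmx1 IH !sub_kermx exprS -mulmxE mulmxA.
Qed.

Lemma rank_chainker_diag (T : Type) (r c : T -> nat)
    (E G : forall x, 'M[F]_(r x, c x)) s k :
  \rank (chainker (diag_blocks E s)^T (diag_blocks G s)^T k) =
  (\sum_(x <- s) \rank (chainker (E x)^T (G x)^T k))%N.
Proof.
elim: s => [|x s IH] /=.
  by rewrite big_nil; apply/eqP; rewrite -leqn0; exact: rank_leq_row.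
by rewrite big_cons !tr_dsum rank_chainker_dsum IH.
Qed.

Lemma rank_chainkerM_diag (T : Type) (r c : T -> nat)
    (E G : forall x, 'M[F]_(r x, c x)) s k :
  \rank (chainker (diag_blocks E s)^T (diag_blocks G s)^T k *m
    (diag_blocks E s)^T) =
  (\sum_(x <- s) \rank (chainker (E x)^T (G x)^T k *m (E x)^T))%N.
Proof.
elim: s => [|x s IH] /=.
  by rewrite big_nil; apply/eqP; rewrite -leqn0; exact: rank_leq_row.
by rewrite big_cons !tr_dsum rank_chainkerM_dsum IH.
Qed.

Lemma diag_blocks_lincomb (T : Type) (r c : T -> nat)
    (E G : forall x, 'M[F]_(r x, c x)) a s :
  diag_blocks E s - a *: diag_blocks G s =
  diag_blocks (fun x => E x - a *: G x) s.
Proof.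
elim: s => [|x s IH] /=; first by rewrite scaler0 subr0.
by rewrite dsum_lincomb IH.
Qed.

Lemma row_free_diag (T : Type) (r c : T -> nat)
    (E : forall x, 'M[F]_(r x, c x)) s :
  (forall x, row_free (E x)) -> row_free (diag_blocks E s).
Proof.
move=> Ef; elim: s => [|x s IH] /=; first by rewrite /row_free mxrank0.
by rewrite /row_free rank_diag_block_mx (eqP (Ef x)) (eqP IH).
Qed.

End Chains.

(** * Ranks for the Kronecker blocks *)

Section Blocks.
Variable F : fieldType.

(** When [f] is onto, each step adds its kernel: [chainker e f k.+1] is the full
    preimage under [f] of [chainker e f k *m e]. *)
Lemma chainker_preim m n (e f : 'M[F]_(m, n)) k : row_full f ->
  \rank (chainker e f k.+1) =
  (\rank (chainker e f k *m e) + (m - n))%N.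
Proof.
move=> ff; rewrite -(mxrank_mul_ker (chainker e f k.+1) f).
congr (_ + _)%N; last first.
  have -> : (chainker e f k.+1 :&: kermx f :=: kermx f)%MS.
    by apply/capmx_idPr; rewrite chainkerSE mulmx_ker sub0mx.
  by rewrite mxrank_ker (eqP ff).
suff -> : (chainker e f k.+1 *m f :=: chainker e f k *m e)%MS by [].
apply/eqmxP; rewrite -chainkerSE submx_refl andTb.
have /submxP[w we] : (chainker e f k *m e <= f)%MS by exact: submx_full.
have wK : (w <= chainker e f k.+1)%MS by rewrite chainkerSE -we submx_refl.
by rewrite we; exact: submxMr wK.
Qed.

(** The kernel of [f] is a line, so the dimension grows by 1 at each step as
    long as [e] is injective on the endpoints.  At step c + 1 the whole space is
    reached. *)
Lemma rank_chainker_singular c (e f : 'M[F]_(c.+1, c)) k : row_full f ->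
  (forall j (v : 'rV_c.+1), (j <= c)%N -> (v <= chainker e f j)%MS ->
     v *m e = 0 -> v = 0) ->
  \rank (chainker e f k) = minn k c.+1 /\
  \rank (chainker e f k *m e) = (minn k.+1 c.+1).-1.
Proof.
move=> ff e_inj; have S j := chainker_preim e j ff; rewrite subSnn in S.
have small j : (j <= c.+1)%N -> \rank (chainker e f j) = j.
  elim: j => [|j IH] jc; first by rewrite /= mxrank0.
  rewrite S addn1 -[in RHS](IH (ltnW jc)); congr _.+1.
  rewrite -(mxrank_mul_ker (chainker e f j) e) -[LHS]addn0; congr (_ + _)%N.
  apply/esym/eqP; rewrite mxrank_eq0 -submx0; apply/rV_subP => v.
  rewrite sub_capmx sub_kermx => /andP[vj /eqP ve].
  by rewrite (e_inj j v _ vj ve) ?sub0mx.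
have all_k j : \rank (chainker e f j) = minn j c.+1.
  have [jc|cj] := leqP j c.+1; first by rewrite small //; lia.
  have := mxrankS (chainker_le e f (ltnW cj)).
  rewrite small //; have := rank_leq_row (chainker e f j); lia.
by split; rewrite // -all_k S addn1.
Qed.

(** A triangular matrix with ones on the diagonal. *)
Lemma N_block_unit a b : 1%:M - b *: N_block F a \in unitmx.
Proof.
rewrite unitmxE det_trig; last first.
  apply/is_trig_mxP => i j ij; rewrite !mxE.
  by rewrite ltn_eqF 1?ltnW // -val_eqE (ltn_eqF ij) mulr0 subr0.
rewrite big1 ?unitr1 // => i _; rewrite !mxE eqxx.
by rewrite (ltn_eqF (ltnSn i)) mulr0 subr0.
Qed.

Lemma mul_tr_L c m (v : 'M[F]_(m, c.+1)) i (j : 'I_c) :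
  (v *m (L_block F c.+1)^T) i j = v i (lift ord0 j).
Proof.
rewrite mxE (bigD1 (lift ord0 j)) //= !mxE eqxx mulr1 big1 ?addr0 // => l lj.
by rewrite !mxE eq_sym -[j.+1]/(val (lift ord0 j)) val_eqE (negPf lj) mulr0.
Qed.

Lemma mul_tr_K c m (v : 'M[F]_(m, c.+1)) i (j : 'I_c) :
  (v *m (K_block F c.+1)^T) i j = v i (widen_ord (leqnSn c) j).
Proof.
set j' := widen_ord _ _.
rewrite mxE (bigD1 j') //= !mxE eqxx mulr1 big1 ?addr0 // => l lj.
by rewrite !mxE eq_sym -[nat_of_ord j]/(val j') val_eqE (negPf lj) mulr0.
Qed.

(** The product (L - l K) L^T is the unipotent matrix I - l N. *)
Lemma row_free_LK b l : row_free (L_block F b - l *: K_block F b).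
Proof.
case: b => [|c]; first by rewrite /row_free eqn_leq rank_leq_row.
apply/row_freeP; exists ((L_block F c.+1)^T *m invmx (1%:M - l *: N_block F c)).
rewrite mulmxA -[RHS](mulmxV (N_block_unit c l)); congr (_ *m _).
by apply/matrixP => i j; rewrite mul_tr_L !mxE.
Qed.

Lemma row_free_K b : row_free (K_block F b).
Proof.
case: b => [|c]; first by rewrite /row_free eqn_leq rank_leq_row.
apply/row_freeP; exists (K_block F c.+1)^T.
by apply/matrixP => i j; rewrite mul_tr_K !mxE.
Qed.

Lemma row_full_tr m n (A : 'M[F]_(m, n)) : row_full A^T = row_free A.
Proof. by rewrite /row_full mxrank_tr. Qed.

(** If x follows y in a chain, then x_(i+1) - l x_i = y_i.  By induction the
    endpoint of a chain of length j is determined by its first j coordinates,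
    while the kernel of K consists of the multiples of the last unit vector. *)
Lemma rank_chainker_KL b l k : (0 < b)%N ->
  let e := (K_block F b)^T in let f := (L_block F b - l *: K_block F b)^T in
  \rank (chainker e f k) = minn k b /\
  \rank (chainker e f k *m e) = (minn k.+1 b).-1.
Proof.
case: b => // c _ e f.
apply: rank_chainker_singular.
  by rewrite /f row_full_tr; exact: (row_free_LK c.+1).
have vf (v : 'rV_c.+1) (j : 'I_c) :
    (v *m f) 0 j = v 0 (lift ord0 j) - l * v 0 (widen_ord (leqnSn c) j).
  rewrite /f linearB linearZ mulmxBr -scalemxAr mxE mul_tr_L.
  by congr (_ + _); rewrite mxE [X in - X = _]mxE mul_tr_K.
have det0 j (v : 'rV_c.+1) : (j <= c.+1)%N -> (v <= chainker e f j)%MS ->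
    (forall i : 'I_c.+1, (i < j)%N -> v 0 i = 0) -> v = 0.
  elim: j v => [|j IH] v jc; first by rewrite submx0 => /eqP.
  rewrite chainkerSE => /submxP[w]; rewrite mulmxA; set y := w *m _ => vy v0.
  have yE (i : 'I_c) : y 0 (widen_ord (leqnSn c) i) =
      v 0 (lift ord0 i) - l * v 0 (widen_ord (leqnSn c) i).
    by rewrite -vf vy mul_tr_K.
  have y0 : y = 0.
    apply: IH; [exact: ltnW | exact: submxMl | move=> i ij].
    have ic : (i < c)%N by lia.
    have -> : i = widen_ord (leqnSn c) (Ordinal ic) by apply: val_inj.
    by rewrite yE !v0 ?mulr0 ?subr0 //=; lia.
  apply/rowP => i; rewrite [RHS]mxE.
  have [n] := ubnP (nat_of_ord i); elim: n i => // n IHn i ilt.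
  have [i0|i0] := posnP (nat_of_ord i); first by apply: v0; rewrite i0.
  have ic : (i.-1 < c)%N by have := ltn_ord i; lia.
  have -> : i = lift ord0 (Ordinal ic) by apply: val_inj; rewrite /= /bump; lia.
  have := yE (Ordinal ic); rewrite y0 mxE => /esym/eqP.
  rewrite subr_eq0 => /eqP->.
  by rewrite IHn ?mulr0 //=; lia.
move=> j v jc vj ve; apply: (det0 j) => //; first exact: leqW.
move=> i ij; have ic : (i < c)%N by lia.
have -> : i = widen_ord (leqnSn c) (Ordinal ic) by apply: val_inj.
by rewrite -mul_tr_K ve mxE.
Qed.

(** The mirror image of [rank_chainker_KL] for l = 0: the last j coordinates
    determine the endpoint of a chain of length j. *)
Lemma rank_chainker_LK b k : (0 < b)%N ->
  let e := (L_block F b)^T in let f := (K_block F b)^T in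
  \rank (chainker e f k) = minn k b /\
  \rank (chainker e f k *m e) = (minn k.+1 b).-1.
Proof.
case: b => // c _ e f.
apply: rank_chainker_singular.
  by rewrite /f row_full_tr; exact: (row_free_K c.+1).
have det0 j (v : 'rV_c.+1) : (j <= c.+1)%N -> (v <= chainker e f j)%MS ->
    (forall i : 'I_c.+1, (c.+1 - j <= i)%N -> v 0 i = 0) -> v = 0.
  elim: j v => [|j IH] v jc; first by rewrite submx0 => /eqP.
  rewrite chainkerSE => /submxP[w]; rewrite mulmxA; set y := w *m _ => vy v0.
  have yE (i : 'I_c) : v 0 (widen_ord (leqnSn c) i) = y 0 (lift ord0 i).
    by rewrite -mul_tr_K vy mul_tr_L.
  have y0 : y = 0.
    apply: IH; [exact: ltnW | exact: submxMl | move=> i ij].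
    have ic : (i.-1 < c)%N by have := ltn_ord i; lia.
    have -> : i = lift ord0 (Ordinal ic).
      by apply: val_inj; rewrite /= /bump; lia.
    by rewrite -yE v0 //=; lia.
  apply/rowP => i; rewrite [RHS]mxE.
  have [ic|ic] := ltnP i c; last by apply: v0; lia.
  have -> : i = widen_ord (leqnSn c) (Ordinal ic) by apply: val_inj.
  by rewrite yE y0 mxE.
move=> j v jc vj ve; apply: (det0 j) => //; first exact: leqW.
move=> i ij; have ic : (i.-1 < c)%N by have := ltn_ord i; lia.
have -> : i = lift ord0 (Ordinal ic) by apply: val_inj; rewrite /= /bump; lia.
by rewrite -mul_tr_L ve mxE.
Qed.

(** Powers of the shift: the endpoints are the vectors that are supported on the
    last k coordinates. *)
Lemma rank_chainker_N a k : \rank (chainker 1%:M (N_block F a)^T k) = minn k a.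
Proof.
suff -> : (chainker 1%:M (N_block F a)^T k
    :=: kermx (pid_mx (a - k) : 'M_a))%MS.
  by rewrite mxrank_ker rank_pid_mx ?leq_subr //; lia.
have ker_pid r (v : 'rV[F]_a) : (v <= kermx (pid_mx r : 'M_a))%MS =
    [forall i : 'I_a, (i < r)%N ==> (v 0 i == 0)].
  have vE i : (v *m (pid_mx r : 'M_a)) 0 i = if (i < r)%N then v 0 i else 0.
    rewrite mxE (bigD1 i) //= !mxE eqxx /= big1 ?addr0 => [|j ji].
      by case: ifP; rewrite ?mulr1 ?mulr0.
    by rewrite !mxE val_eqE (negPf ji) mulr0.
  rewrite sub_kermx; apply/eqP/forallP => [v0 i|v0].
    by apply/implyP => ir; have := vE i; rewrite ir v0 mxE => <-.
  apply/rowP => i; rewrite vE mxE.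
  by case: ifP => // ir; have /implyP/(_ ir)/eqP := v0 i.
elim: k => [|k IH].
  apply/eqmxP; rewrite sub0mx subn0 pid_mx_1.
  by rewrite -[kermx _]mulmx1 mulmx_ker sub0mx.
apply/eqmxP/rV_eqP => v; rewrite chainkerSE mulmx1 IH !ker_pid.
have vN (i : 'I_a) (i1 : (i.+1 < a)%N) :
    (v *m (N_block F a)^T) 0 (Ordinal i1) = v 0 i.
  rewrite mxE (bigD1 i) //= !mxE /= eqxx mulr1 big1 ?addr0 // => j ji.
  by rewrite !mxE /= eqSS eq_sym val_eqE (negPf ji) mulr0.
apply/forallP/forallP => v0 i; apply/implyP => ik.
  have i1 : (i.+1 < a)%N by lia.
  by rewrite -(vN i i1); apply: (implyP (v0 _)) => /=; lia.
have [i0|i0] := posnP (nat_of_ord i).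
  rewrite mxE big1 // => j _; rewrite !mxE i0 /=.
  by rewrite mulr0.
have i1 : (i.-1 < a)%N by have := ltn_ord i; lia.
have i2 : ((Ordinal i1).+1 < a)%N by rewrite /= prednK.
have -> : i = Ordinal i2 by apply: val_inj; rewrite /= prednK.
by rewrite vN; apply: (implyP (v0 _)) => /=; lia.
Qed.

End Blocks.

(** * Ranks for the Kronecker canonical form *)

Section Kronecker.
Variable F : fieldType.

(** Coefficient of s in the Kronecker canonical form. *)
Definition kron_lead (J : seq (F * nat)) (alpha beta gamma : seq nat) :=
  dsum (1%:M : 'M[F]_(sumn (map snd J)))
    (dsum (N_mx F alpha) (dsum (K_mx F beta) (K_mx F gamma)^T)).

Definition kron_const (J : seq (F * nat)) (alpha beta gamma : seq nat) :=
  dsum (jordan_mx J)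
    (dsum (1%:M : 'M[F]_(sumn (map id alpha)))
      (dsum (L_mx F beta) (L_mx F gamma)^T)).

Lemma pencil_dsum m1 n1 m2 n2 (A1 B1 : 'M[F]_(m1, n1))
    (A2 B2 : 'M[F]_(m2, n2)) :
  pencil (dsum A1 A2) (dsum B1 B2) = dsum (pencil A1 B1) (pencil A2 B2).
Proof.
rewrite /pencil /dsum !map_block_mx !map_mx0 scale_block_mx opp_block_mx.
by rewrite add_block_mx !scaler0 !subr0.
Qed.

Lemma kronecker_pencilE J alpha beta gamma :
  kronecker_pencil J alpha beta gamma =
  pencil (kron_lead J alpha beta gamma) (kron_const J alpha beta gamma).
Proof. by rewrite !pencil_dsum. Qed.

(** The identity has to be cut into blocks to be treated together with
    [N_mx]. *)
Lemma diag_blocks1 (alpha : seq nat) :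
  1%:M = diag_blocks (fun k => 1%:M : 'M[F]_k) alpha
    :> 'M_(sumn (map id alpha)).
Proof.
elim: alpha => [|a alpha IH] /=; first by apply/matrixP => -[].
by rewrite scalar_mx_block -IH.
Qed.

Lemma N_mx_unit (alpha : seq nat) b : 1%:M - b *: N_mx F alpha \in unitmx.
Proof.
rewrite diag_blocks1 diag_blocks_lincomb -row_free_unit.
by apply: row_free_diag => a; rewrite row_free_unit N_block_unit.
Qed.

Lemma row_free_LK_mx (gamma : seq nat) b :
  row_free (L_mx F gamma - b *: K_mx F gamma).
Proof.
by rewrite diag_blocks_lincomb; apply: row_free_diag => c; exact: row_free_LK.
Qed.

Lemma row_free_K_mx (gamma : seq nat) : row_free (K_mx F gamma).
Proof. by apply: row_free_diag => c; exact: row_free_K. Qed.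

Lemma big_all_eq (s : seq nat) (f g : nat -> nat) :
  all (leq 1) s -> (forall b, (0 < b)%N -> f b = g b) ->
  (\sum_(x <- s) f x = \sum_(x <- s) g x)%N.
Proof.
move=> /allP s1 fg; rewrite big_seq_cond [RHS]big_seq_cond.
by apply: eq_bigr => x; rewrite andbT => /s1/fg.
Qed.

(** Only the Jordan blocks and the blocks sK - L contribute: on the other two
    kinds the matrix F - l E acts injectively. *)
Lemma rank_kron_finite J alpha beta gamma (l : F) k :
  all (leq 1) beta ->
  let E := kron_lead J alpha beta gamma in
  let G := kron_const J alpha beta gamma - l *: E in
  \rank (chainker E^T G^T k) =
    (dim_ker ((jordan_mx J - l%:M) ^+ k) + \sum_(b <- beta) minn k b)%N /\
  \rank (chainker E^T G^T k *m E^T) =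
    (dim_ker ((jordan_mx J - l%:M) ^+ k) + \sum_(b <- beta) (minn k.+1 b).-1)%N.
Proof.
move=> b1 E G; rewrite /G /E !dsum_lincomb !tr_dsum scalemx1.
have fN : row_free (1%:M - l *: N_mx F alpha)^T.
  by rewrite row_free_unit unitmx_tr N_mx_unit.
have fK : row_free ((L_mx F gamma)^T - l *: (K_mx F gamma)^T)^T.
  by rewrite linearB linearZ /= !trmxK row_free_LK_mx.
rewrite !rank_chainker_dsum !rank_chainkerM_dsum.
rewrite ![chainker (N_mx F alpha)^T _ _]chainker_free //.
rewrite ![chainker (K_mx F gamma)^T^T _ _]chainker_free //.
rewrite !mul0mx !mxrank0 !add0n !addn0 trmx1 mulmx1 rank_chainker1.
rewrite diag_blocks_lincomb rank_chainker_diag rank_chainkerM_diag.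
split; congr (_ + _)%N; apply: big_all_eq => // b b0.
  by case: (rank_chainker_KL l k b0).
by case: (rank_chainker_KL l k b0).
Qed.

(** After the exchange of E and F the blocks sN - I play the part of nilpotent
    Jordan blocks, and the proper Jordan blocks do not contribute. *)
Lemma rank_kron_infinite J alpha beta gamma k :
  all (leq 1) beta ->
  let E := kron_lead J alpha beta gamma in
  let G := kron_const J alpha beta gamma in
  \rank (chainker G^T E^T k) =
    (\sum_(a <- alpha) minn k a + \sum_(b <- beta) minn k b)%N /\
  \rank (chainker G^T E^T k *m G^T) =
    (\sum_(a <- alpha) minn k a + \sum_(b <- beta) (minn k.+1 b).-1)%N.
Proof.
move=> b1 E G; rewrite /G /E !tr_dsum.
rewrite !rank_chainker_dsum !rank_chainkerM_dsum.
have f1 : row_free (1%:M : 'M[F]_(sumn (map snd J)))^T.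
  by rewrite row_free_unit trmx1 unitmx1.
rewrite ![chainker (jordan_mx J)^T _ _]chainker_free //.
rewrite !trmxK ![chainker (L_mx F gamma) _ _]chainker_free ?row_free_K_mx //.
rewrite !mul0mx !mxrank0 !add0n !addn0 !trmx1 mulmx1.
rewrite rank_chainker_diag rank_chainkerM_diag.
rewrite -[1%:M]trmx1 diag_blocks1 rank_chainker_diag.
have -> : (\sum_(a <- alpha)
    \rank (chainker (1%:M : 'M[F]_a)^T (N_block F a)^T k) =
    \sum_(a <- alpha) minn k a)%N.
  by apply: eq_bigr => a _; rewrite trmx1 rank_chainker_N.
split; congr (_ + _)%N; apply: big_all_eq => // b b0.
  by case: (rank_chainker_LK F k b0).
by case: (rank_chainker_LK F k b0).
Qed.

Lemma pencil_inj n m (A B A' B' : 'M[F]_(n, m)) :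
  pencil A B = pencil A' B' -> A = A' /\ B = B'.
Proof.
have co (C D : 'M[F]_(n, m)) i j l : (pencil C D i j)`_l =
    (l == 1%N)%:R * C i j - (l == 0%N)%:R * D i j.
  rewrite !mxE coefB coefXM !coefC.
  by case: l => [|[|l]] //=; rewrite ?mul0r ?mul1r ?subr0 ?sub0r.
move/matrixP => AB; split; apply/matrixP => i j.
  have := congr1 (fun p : {poly F} => p`_1) (AB i j).
  by rewrite !co /= !mul1r !mul0r !subr0.
have := congr1 (fun p : {poly F} => p`_0) (AB i j).
by rewrite !co /= !mul1r !mul0r !sub0r => /oppr_inj.
Qed.

Lemma mul_pencil n m (V : 'M[F]_n) (U : 'M[F]_m) (A B : 'M[F]_(n, m)) :
  map_mx polyC V *m pencil A B *m map_mx polyC U =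
  pencil (V *m A *m U) (V *m B *m U).
Proof.
by rewrite /pencil mulmxBr mulmxBl -scalemxAr -scalemxAl -!map_mxM.
Qed.

Lemma rank_chainker_trE n m (V : 'M[F]_n) (U : 'M[F]_m) (A B : 'M[F]_(n, m)) k :
  V \in unitmx -> U \in unitmx ->
  \rank (chainker (V *m A *m U)^T (V *m B *m U)^T k) =
    \rank (chainker A^T B^T k) /\
  \rank (chainker (V *m A *m U)^T (V *m B *m U)^T k *m (V *m A *m U)^T) =
    \rank (chainker A^T B^T k *m A^T).
Proof.
move=> uV uU; have trE (C : 'M[F]_(n, m)) : (V *m C *m U)^T = U^T *m C^T *m V^T.
  by rewrite !trmx_mul mulmxA.
by rewrite !trE rank_chainker_equiv ?rank_chainkerM_equiv ?unitmx_tr.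
Qed.

(** The dimensions of the kernels of powers are invariant under strict
    equivalence, so they can be read off from the canonical form. *)
Lemma kronecker_form_ranks n m (E G : 'M[F]_(n, m)) J alpha beta gamma :
  kronecker_form (pencil E G) J alpha beta gamma -> forall k,
  (forall l, let D := dim_ker ((jordan_mx J - l%:M) ^+ k) in
    \rank (chainker E^T (G - l *: E)^T k) =
      (D + \sum_(b <- beta) minn k b)%N /\
    \rank (chainker E^T (G - l *: E)^T k *m E^T) =
      (D + \sum_(b <- beta) (minn k.+1 b).-1)%N) /\
  (\rank (chainker G^T E^T k) =
     (\sum_(a <- alpha) minn k a + \sum_(b <- beta) minn k b)%N /\
   \rank (chainker G^T E^T k *m G^T) =
     (\sum_(a <- alpha) minn k a + \sum_(b <- beta) (minn k.+1 b).-1)%N).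
Proof.
case=> _ _ /andP[b1 _] _ [V [U [[dn dm] [uV uU]]]] + k.
move: dn dm; rewrite kronecker_pencilE => dn dm; subst n m.
rewrite castmx_id mul_pencil => /pencil_inj[VE VG]; split=> [l|].
  have := rank_kron_finite J alpha gamma l k b1.
  rewrite /= -VE -VG; have -> : V *m G *m U - l *: (V *m E *m U) =
    V *m (G - l *: E) *m U.
    by rewrite mulmxBr mulmxBl -scalemxAr -scalemxAl.
  by have [-> ->] := rank_chainker_trE E (G - l *: E) k uV uU.
have := rank_kron_infinite J alpha gamma k b1.
by rewrite /= -VE -VG; have [-> ->] := rank_chainker_trE G E k uV uU.
Qed.

End Kronecker.

(** * Pencils of rank one *)

Section RankOne.
Variable F : fieldType.

Lemma linear_root_factor (p : {poly F}) r :
  (size p <= 2)%N -> root p r -> exists c, p = c *: ('X - r%:P).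
Proof.
move=> p2 /factor_theorem[q pq]; exists q`_0.
have [q0|q0] := eqVneq q 0; first by rewrite pq q0 mul0r coef0 scale0r.
move: p2; rewrite pq size_Mmonic ?monicXsubC // size_XsubC addn2 /= ltnS => q1.
by rewrite -mul_polyC -size1_polyC.
Qed.

(** If [p] is a constant, comparison of degrees in [t * p = q * s] shows that
    [q] or [s] is a constant.  Otherwise the root of [p] is a root of [q] or
    of [s]. *)
Lemma linear_proportional (p q s t : {poly F}) :
  p != 0 -> (size p <= 2)%N -> (size q <= 2)%N -> (size s <= 2)%N ->
  (size t <= 2)%N -> t * p = q * s ->
  (exists c, q = c *: p) \/ (exists c, s = c *: p).
Proof.
move=> p0 p2 q2 s2 t2 tp.
have [p1|p1] := leqP (size p) 1.
  have pc := size1_polyC p1; set c := p`_0 in pc.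
  have c0 : c != 0 by apply: contraNneq p0 => c0; rewrite pc c0.
  have mult (h : {poly F}) : (size h <= 1)%N -> exists d, h = d *: p.
    move=> h1; exists (h`_0 / c).
    by rewrite pc -mul_polyC -polyCM divfK // -size1_polyC.
  have [q1|q1] := leqP (size q) 1; first by left; exact: mult.
  have [s1|s1] := leqP (size s) 1; first by right; exact: mult.
  have : (size (q * s)%R <= 2)%N.
    by rewrite -tp pc mulrC mul_polyC size_scale.
  have q0 : q != 0 by rewrite -size_poly_gt0; lia.
  have s0 : s != 0 by rewrite -size_poly_gt0; lia.
  rewrite size_mul // -ltnS.
  by move/(leq_trans (leq_trans (leq_add q1 s1) (leqSpred _))).
have [r rp] : exists r, root p r.
  have [|r] := @poly2_root _ p; last by exists r.
  by apply/eqP; rewrite eqn_leq p2.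
have [c pc] := linear_root_factor p2 rp.
have c0 : c != 0 by apply: contraNneq p0 => c0; rewrite pc c0 scale0r.
have mult (h : {poly F}) : (size h <= 2)%N -> root h r -> exists d, h = d *: p.
  move=> h2 /(linear_root_factor h2)[d ->]; exists (d / c).
  by rewrite pc scalerA divfK.
have : root (q * s) r by rewrite -tp rootM rp orbT.
by rewrite rootM => /orP[qr|sr]; [left | right]; exact: mult.
Qed.

Lemma det_mx2 (R : comRingType) (A : 'M[R]_2) :
  \det A = A 0 0 * A 1 1 - A 0 1 * A 1 0.
Proof.
rewrite (expand_det_row A 0) !big_ord_recl big_ord0 addr0 /cofactor !det_mx11.
rewrite !mxE /= expr0 expr1 mul1r mulN1r mulrN.
congr (_ * A _ _ - A _ _ * A _ _).
all: by apply: val_inj.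
Qed.

(** A nonzero 2 x 2 minor would make the normal rank at least 2. *)
Lemma normal_rank_minors n m (M : 'M[{poly F}]_(n, m)) i i' j j' :
  (normal_rank M <= 1)%N -> M i j * M i' j' = M i j' * M i' j.
Proof.
move=> rM.
have minor (k k' : 'I_n) (l l' : 'I_m) : (k < k')%N -> (l < l')%N ->
    M k l * M k' l' = M k l' * M k' l.
  move=> kk ll; apply/eqP; rewrite -subr_eq0; apply: contraLR rM => det0.
  have two : (2 < (minn n m).+1)%N.
    by have := ltn_ord k'; have := ltn_ord l'; lia.
  rewrite -ltnNge; apply: leq_trans (leq_bigmax_cond (Ordinal two) _) => //.
  pose f := [ffun x : 'I_2 => if x == 0 then k else k'].
  pose g := [ffun x : 'I_2 => if x == 0 then l else l'].
  apply/existsP; exists f; apply/existsP; exists g.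
  apply/and3P; split.
  - apply/forallP => -[[|[|x]] xlt] //; apply/forallP => -[[|[|y]] ylt] //.
    by rewrite !ffunE; apply/implyP.
  - apply/forallP => -[[|[|x]] xlt] //; apply/forallP => -[[|[|y]] ylt] //.
    by rewrite !ffunE; apply/implyP.
  by rewrite /regular eqxx conform_mx_id det_mx2 !mxE !ffunE.
have [ii|ii|/val_inj->] := ltngtP i i'; last by rewrite mulrC.
  have [jj|jj|/val_inj->] := ltngtP j j'; last by [].
    exact: minor.
  by rewrite -minor.
have [jj|jj|/val_inj->] := ltngtP j j'; last by [].
  by rewrite mulrC [RHS]mulrC -minor.
by rewrite mulrC [RHS]mulrC minor.
Qed.

Lemma size_pencil n m (A B : 'M[F]_(n, m)) i j : (size (pencil A B i j) <= 2)%N.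
Proof.
rewrite !mxE (leq_trans (size_polyD _ _)) // geq_max size_polyN.
rewrite (leq_trans (size_polyC_leq1 _)) // andbT mulrC mul_polyC.
by rewrite (leq_trans (size_scale_leq _ _)) // size_polyX.
Qed.

(** Fix a nonzero entry M_00.  From M_ij M_00 = M_i0 M_0j and
    [linear_proportional], either every entry M_i0 of its column is a constant
    multiple of M_00, or every entry M_0j of its row is. *)
Lemma rank_one_pencil n m (A B : 'M[F]_(n, m)) :
  (normal_rank (pencil A B) <= 1)%N ->
  (exists (p : 'cV_n) (u v : 'rV_m), A = p *m u /\ B = p *m v) \/
  (exists (p : 'rV_m) (u v : 'cV_n), A = u *m p /\ B = v *m p).
Proof.
move=> rM; set M := pencil A B in rM.
have minors i i' j j' := normal_rank_minors i i' j j' rM.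
have [/existsP[i0 /existsP[j0 M0]]|] :=
  boolP [exists i, exists j, M i j != 0]; last first.
  move=> /existsPn M0; left; exists 0, 0, 0; rewrite !mul0mx; apply: pencil_inj.
  apply/matrixP => i j; have /existsPn/(_ j)/negPn/eqP := M0 i.
  by rewrite /M => ->; rewrite !mxE mulr0 subr0.
have split2 i j := linear_proportional M0 (size_pencil A B i0 j0)
  (size_pencil A B i j0) (size_pencil A B i0 j) (size_pencil A B i j).
have [/fin_all_exists[c cE]|ncol] :=
    pselect (forall i, exists c, M i j0 = c *: M i0 j0).
  left; exists (\col_i c i), (row i0 A), (row i0 B); apply: pencil_inj.
  apply/matrixP => i j; rewrite -/M.
  have : M i j = c i *: M i0 j.
    by apply: (mulfI M0); rewrite [LHS]minors cE -!scalerAr mulrC.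
  rewrite /M !mxE !big_ord1 !mxE !polyCM scalerBr -!mul_polyC => ->.
  by rewrite mulrCA.
right; have [j1 j1P] : exists i, ~ exists c, M i j0 = c *: M i0 j0.
  exact/existsNP.
have dex j : exists c, M i0 j = c *: M i0 j0.
  by have [|/j1P|] := split2 j1 j; first by rewrite mulrC minors mulrC.
have [d dE] := fin_all_exists dex.
exists (\row_j d j), (col j0 A), (col j0 B); apply: pencil_inj.
apply/matrixP => i j; rewrite -/M.
have : M i j = d j *: M i j0.
  by apply: (mulfI M0); rewrite minors dE -scalerAr -scalerAl.
rewrite /M !mxE !big_ord1 !mxE !polyCM scalerBr -!mul_polyC => ->.
by rewrite ![_ * (d j)%:P]mulrC mulrCA.
Qed.

End RankOne.

(** * Perturbation of the Weyr characteristic *)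

Section PencilPerturbation.
Variable F : fieldType.

(** A perturbation of column type acts on the relation E^-1 F. *)
Lemma rank_chainker_perturb_col m n (e f : 'M[F]_(m, n)) (u v : 'cV_m)
    (p : 'rV_n) k :
  let r := chainker e f in let r' := chainker (e + u *m p) (f + v *m p) in
  (\rank (r k.+1) + \rank (r' k) <= \rank (r' k.+1) + \rank (r k) + k.+1)%N /\
  (no_singular_chain (kerrel (e + u *m p) (f + v *m p)) ->
   \rank (r k.+1) + \rank (r' k) <= \rank (r' k.+1) + \rank (r k) + 1)%N.
Proof.
move=> r r'; have le1 := kerrel_perturb e f u v p.
have := kerrel_perturb (e + u *m p) (f + v *m p) (- u) (- v) p.
rewrite !mulNmx !addrK capmxC => le2.
have := relker_perturb le1 le2 k; rewrite !relker_kerrel => leq; split=> // ns.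
by have := relker_perturb_regular le1 k ns; rewrite !relker_kerrel.
Qed.

(** A perturbation of row type acts on the relation F E^-1. *)
Lemma rank_chainker_perturb_row m n (e f : 'M[F]_(m, n)) (u v : 'rV_n)
    (p : 'cV_m) k :
  let e' := e + p *m u in
  let r k := chainker e f k *m e in
  let r' k := chainker e' (f + p *m v) k *m e' in
  (\rank (r k.+1) + \rank (r' k) <= \rank (r' k.+1) + \rank (r k) + k.+1)%N /\
  (no_singular_chain (imrel (e + p *m u) (f + p *m v)) ->
   \rank (r k.+1) + \rank (r' k) <= \rank (r' k.+1) + \rank (r k) + 1)%N.
Proof.
move=> e' r r'; have le1 := imrel_perturb e f u v p.
have := imrel_perturb (e + p *m u) (f + p *m v) (- u) (- v) p.
rewrite !mulmxN !addrK capmxC => le2.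
have := relker_perturb le1 le2 k; rewrite !relker_imrel => leq; split=> // ns.
by have := relker_perturb_regular le1 k ns; rewrite !relker_imrel.
Qed.

Lemma sum_minnS (s : seq nat) k :
  (\sum_(b <- s) minn k.+1 b =
   \sum_(b <- s) minn k b + conjugate_partition s k.+1)%N.
Proof.
elim: s => [|b s IH]; first by rewrite !big_nil.
by rewrite !big_cons IH /conjugate_partition /=; lia.
Qed.

Lemma sum_pred_minnS (s : seq nat) k :
  (\sum_(b <- s) (minn k.+2 b).-1 =
   \sum_(b <- s) (minn k.+1 b).-1 + conjugate_partition s k.+2)%N.
Proof.
elim: s => [|b s IH]; first by rewrite !big_nil.
by rewrite !big_cons IH /conjugate_partition /=; lia.
Qed.

Lemma weyr_mxS n (A : 'M[F]_n) l k :
  dim_ker ((A - l%:M) ^+ k.+1) =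
  (dim_ker ((A - l%:M) ^+ k) + weyr_mx A l k.+1)%N.
Proof.
rewrite /weyr_mx subnKC // -!rank_chainker1.
exact/mxrankS/chainkerS.
Qed.

(** The increments of the kernel dimensions of the relations E^-1 F and F E^-1
    are the combinations of Weyr characteristics in the theorem. *)
Lemma weyr_increments n m (E G : 'M[F]_(n, m)) w a b c :
  weyr_characteristic (pencil E G) w a b c -> forall k,
  (forall l, let r := chainker E^T (G - l *: E)^T in
     \rank (r k.+1) = (\rank (r k) + (w l k.+1 + b k.+1))%N /\
     \rank (r k.+1 *m E^T) = (\rank (r k *m E^T) + (w l k.+1 + b k.+2))%N) /\
  (let r := chainker G^T E^T in
     \rank (r k.+1) = (\rank (r k) + (a k.+1 + b k.+1))%N /\
     \rank (r k.+1 *m G^T) = (\rank (r k *m G^T) + (a k.+1 + b k.+2))%N).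
Proof.
case=> J [alpha [beta [gamma [/kronecker_form_ranks ranks wE]]]] k.
have [fin [i0 i1]] := ranks k; have [finS [iS0 iS1]] := ranks k.+1.
have [wk ak bk _] := wE k.+1 isT; have [_ _ bk1 _] := wE k.+2 isT.
split=> [l|] r.
  have [f0 f1] := fin l; have [fS0 fS1] := finS l.
  rewrite /r fS0 fS1 f0 f1 wk bk bk1 weyr_mxS sum_minnS sum_pred_minnS.
  by split; lia.
rewrite /r iS0 iS1 i0 i1 ak bk bk1 !sum_minnS sum_pred_minnS.
by split; lia.
Qed.

(** At a point l where the pencil is invertible there are no chains at all,
    whereas each block of [beta] would contribute at least one.  So [beta] is
    empty, and then the two dimension formulas agree. *)
Lemma weyr_regular n m (E G : 'M[F]_(n, m)) w a b c :
  (exists l, row_free (G - l *: E)^T) ->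
  weyr_characteristic (pencil E G) w a b c ->
  [/\ forall k, (1 <= k)%N -> b k = 0%N,
      forall l k, \rank (chainker E^T (G - l *: E)^T k *m E^T) =
                  \rank (chainker E^T (G - l *: E)^T k)
    & forall k, \rank (chainker G^T E^T k *m G^T) = \rank (chainker G^T E^T k)].
Proof.
move=> [l lP] [J [alpha [beta [gamma [PJ wE]]]]].
have beta0 : beta = [::].
  have [_ _ /andP[b1 _] _ _] := PJ.
  have [/(_ l)[+ _] _] := kronecker_form_ranks PJ 1.
  rewrite chainker_free // mxrank0.
  case: beta b1 {PJ wE} => //= b0 s /andP[b1 _].
  by rewrite big_cons; lia.
rewrite {}beta0 in PJ wE; split=> [k k1|l' k|k].
- by have [_ _ -> _] := wE k k1.
- by have [/(_ l')[-> ->] _] := kronecker_form_ranks PJ k; rewrite !big_nil.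
- by have [_ [-> ->]] := kronecker_form_ranks PJ k; rewrite !big_nil.
Qed.

Lemma pencilB n m (A B A' B' : 'M[F]_(n, m)) :
  pencil A B - pencil A' B' = pencil (A - A') (B - B').
Proof.
by rewrite /pencil !map_mxB scalerBr !opprD addrACA.
Qed.

Section Main.
Variables (n m : nat) (E G E' G' : 'M[F]_(n, m)) (lambda : F).
Variables (w w' : F -> nat -> nat) (a b c a' b' c' : nat -> nat).
Hypothesis weyrP : weyr_characteristic (pencil E G) w a b c.
Hypothesis weyrQ : weyr_characteristic (pencil E' G') w' a' b' c'.

Lemma weyr_perturb_col (u v : 'rV_m) (p : 'cV_n) k :
  E' = E + p *m u -> G' = G + p *m v -> (1 <= k)%N ->
  [/\ (w lambda k + b k <= w' lambda k + b' k + k)%N,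
      (a k + b k <= a' k + b' k + k)%N
    & (exists l, row_free (G' - l *: E')^T) ->
      (w lambda k + b k <= w' lambda k + b' k + 1)%N /\
      (a k + b k <= a' k + b' k + 1)%N].
Proof.
case: k => // k eE eG _.
have [/(_ lambda)[r0 _] [i0 _]] := weyr_increments weyrP k.
have [/(_ lambda)[r0' _] [i0' _]] := weyr_increments weyrQ k.
have eE' : E'^T = E^T + u^T *m p^T by rewrite eE linearD /= trmx_mul.
have eG' : G'^T = G^T + v^T *m p^T by rewrite eG linearD /= trmx_mul.
have eGl : (G' - lambda *: E')^T =
    (G - lambda *: E)^T + (v - lambda *: u)^T *m p^T.
  rewrite -trmx_mul -linearD /= eE eG mulmxBr -scalemxAr scalerDr opprD.
  by rewrite addrACA.
have [le le1] := rank_chainker_perturb_col E^T (G - lambda *: E)^T u^T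
  (v - lambda *: u)^T p^T k.
have [ile ile1] := rank_chainker_perturb_col G^T E^T v^T u^T p^T k.
rewrite -eE' -eGl in le le1; rewrite -eE' -eG' in ile ile1.
split; [lia | lia | move=> regQ].
have [_ rQ iQ] := weyr_regular regQ weyrQ.
have := le1 (kerrel_no_singular (rQ lambda)).
by have := ile1 (kerrel_no_singular iQ); split; lia.
Qed.

Lemma weyr_perturb_row (u v : 'cV_n) (p : 'rV_m) k :
  E' = E + u *m p -> G' = G + v *m p -> (1 <= k)%N ->
  [/\ (w lambda k + b k.+1 <= w' lambda k + b' k.+1 + k)%N,
      (a k + b k.+1 <= a' k + b' k.+1 + k)%N
    & (exists l, row_free (G' - l *: E')^T) ->
      (w lambda k + b k.+1 <= w' lambda k + b' k.+1 + 1)%N /\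
      (a k + b k.+1 <= a' k + b' k.+1 + 1)%N].
Proof.
case: k => // k eE eG _.
have [/(_ lambda)[_ r0] [_ i0]] := weyr_increments weyrP k.
have [/(_ lambda)[_ r0'] [_ i0']] := weyr_increments weyrQ k.
have eE' : E'^T = E^T + p^T *m u^T by rewrite eE linearD /= trmx_mul.
have eG' : G'^T = G^T + p^T *m v^T by rewrite eG linearD /= trmx_mul.
have eGl : (G' - lambda *: E')^T =
    (G - lambda *: E)^T + p^T *m (v - lambda *: u)^T.
  rewrite -trmx_mul -linearD /= eE eG mulmxBl -scalemxAl scalerDr opprD.
  by rewrite addrACA.
have [le le1] := rank_chainker_perturb_row E^T (G - lambda *: E)^T u^T
  (v - lambda *: u)^T p^T k.
have [ile ile1] := rank_chainker_perturb_row G^T E^T v^T u^T p^T k.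
rewrite -eE' -eGl in le le1; rewrite -eE' -eG' in ile ile1.
split; [lia | lia | move=> regQ].
have [_ rQ iQ] := weyr_regular regQ weyrQ.
have := le1 (imrel_no_singular (rQ lambda)).
by have := ile1 (imrel_no_singular iQ); split; lia.
Qed.

End Main.
End PencilPerturbation.

Section Regular.
Variable F : numFieldType.

Lemma poly_nonroot (p : {poly F}) : p != 0 -> exists x, ~~ root p x.
Proof.
move=> p0; apply: contrapT => /forallNP allroot.
(* Characteristic 0 gives more points than a nonzero polynomial has roots. *)
pose rs := [seq i%:R | i <- iota 0 (size p)] : seq F.
have : (size rs < size p)%N.
  apply: max_poly_roots => //; first by apply/allP => x _; apply/negPn/negP.
  by rewrite map_inj_uniq ?iota_uniq // => i j /eqP; rewrite eqr_nat => /eqP.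
by rewrite size_map size_iota ltnn.
Qed.

Lemma regular_unit n m (E G : 'M[F]_(n, m)) : regular (pencil E G) ->
  exists l, row_free (G - l *: E)^T.
Proof.
case/andP => /eqP nm; subst m; rewrite conform_mx_id => /poly_nonroot[l].
rewrite rootE => det0; exists l.
have -> : G - l *: E = -1 *: map_mx (horner_eval l) (pencil E G).
  apply/matrixP => i j; rewrite !mxE /horner_eval !hornerE.
  by rewrite mulN1r opprB.
rewrite row_free_unit unitmx_tr unitmxE detZ det_map_mx unitfE.
by rewrite mulf_neq0 // expf_neq0 // oppr_eq0 oner_neq0.
Qed.

End Regular.

Lemma distn_leP (x y k : nat) : (x <= y + k)%N -> (y <= x + k)%N ->
  `|x%:Z - y%:Z| <= k%:Z.
Proof. by move=> xy yx; lia. Qed.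

Theorem theorem7p4 (R : realType) (n m : nat)
    (E F E' F' : 'M[R[i]]_(n, m)) (P Q : 'M[{poly R[i]}]_(n, m))
    (defP : P = pencil E F) (defQ : Q = pencil E' F')
    (lambda : R[i]) (eig_lambda : pencil_eigenvalue P lambda)
    (w w' : R[i] -> nat -> nat) (a b c a' b' c' : nat -> nat)
    (weyrP : weyr_characteristic P w a b c)
    (weyrQ : weyr_characteristic Q w' a' b' c')
    (rank1 : normal_rank (P - Q) = 1%N) :
  [/\ forall (u v : 'cV[R[i]]_m) (p : 'cV[R[i]]_n),
        (u, v) <> (0, 0) -> p <> 0 ->
        Q - P = map_mx polyC p *m pencil (u ^t*) (v ^t*) ->
        forall k : nat, (1 <= k)%N ->
          `|(w lambda k + b k)%N%:Z - (w' lambda k + b' k)%N%:Z| <= k%:Z /\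
          `|(a k + b k)%N%:Z - (a' k + b' k)%N%:Z| <= k%:Z,
      forall (u v : 'cV[R[i]]_n) (p : 'cV[R[i]]_m),
        (u, v) <> (0, 0) -> p <> 0 ->
        Q - P = pencil u v *m map_mx polyC (p ^t*) ->
        forall k : nat, (1 <= k)%N ->
          `|(w lambda k + b k.+1)%N%:Z - (w' lambda k + b' k.+1)%N%:Z| <= k%:Z /\
          `|(a k + b k.+1)%N%:Z - (a' k + b' k.+1)%N%:Z| <= k%:Z
    & regular P -> regular Q ->
        forall k : nat, (1 <= k)%N ->
          [/\ b k = 0%N, b' k = 0%N,
              `|(w lambda k)%:Z - (w' lambda k)%:Z| <= 1
            & `|(a k)%:Z - (a' k)%:Z| <= 1]].
Proof.
move: weyrP weyrQ rank1; rewrite {}defQ {}defP {P Q eig_lambda}.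
move=> weyrP weyrQ rank1.
split.
- move=> u v p _ _ diff k k1.
  have [dE dF] : E' - E = p *m u ^t* /\ F' - F = p *m v ^t*.
    apply: pencil_inj; rewrite -pencilB diff /pencil.
    by rewrite mulmxBr -scalemxAr -!map_mxM.
  have eE : E' = E + p *m u ^t* by rewrite -dE addrC subrK.
  have eF : F' = F + p *m v ^t* by rewrite -dF addrC subrK.
  have oE : E = E' + p *m (- u ^t*) by rewrite mulmxN eE addrK.
  have oF : F = F' + p *m (- v ^t*) by rewrite mulmxN eF addrK.
  have [wl al _] := weyr_perturb_col lambda weyrP weyrQ eE eF k1.
  have [wr ar _] := weyr_perturb_col lambda weyrQ weyrP oE oF k1.
  by split; exact: distn_leP.
- move=> u v p _ _ diff k k1.
  have [dE dF] : E' - E = u *m p ^t* /\ F' - F = v *m p ^t*.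
    apply: pencil_inj; rewrite -pencilB diff /pencil.
    by rewrite mulmxBl -scalemxAl -!map_mxM.
  have eE : E' = E + u *m p ^t* by rewrite -dE addrC subrK.
  have eF : F' = F + v *m p ^t* by rewrite -dF addrC subrK.
  have oE : E = E' + (- u) *m p ^t* by rewrite mulNmx eE addrK.
  have oF : F = F' + (- v) *m p ^t* by rewrite mulNmx eF addrK.
  have [wl al _] := weyr_perturb_row lambda weyrP weyrQ eE eF k1.
  have [wr ar _] := weyr_perturb_row lambda weyrQ weyrP oE oF k1.
  by split; exact: distn_leP.
move=> /regular_unit regP /regular_unit regQ k k1.
have [bP _ _] := weyr_regular regP weyrP.
have [bQ _ _] := weyr_regular regQ weyrQ.
have [] : _ \/ _ := @rank_one_pencil _ _ _ (E - E') (F - F') _.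
- by rewrite -pencilB rank1.
- case=> p [u [v [dE dF]]].
  have oE : E = E' + p *m u by rewrite -dE addrC subrK.
  have oF : F = F' + p *m v by rewrite -dF addrC subrK.
  have eE : E' = E + p *m - u by rewrite mulmxN oE addrK.
  have eF : F' = F + p *m - v by rewrite mulmxN oF addrK.
  have [_ _ /(_ regQ)[wl al]] := weyr_perturb_col lambda weyrP weyrQ eE eF k1.
  have [_ _ /(_ regP)[wr ar]] := weyr_perturb_col lambda weyrQ weyrP oE oF k1.
  rewrite bP ?bQ // !addn0 in wl al wr ar.
  by split; rewrite ?bP ?bQ //; exact: distn_leP.
case=> p [u [v [dE dF]]].
have oE : E = E' + u *m p by rewrite -dE addrC subrK.
have oF : F = F' + v *m p by rewrite -dF addrC subrK.
have eE : E' = E + (- u) *m p by rewrite mulNmx oE addrK.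
have eF : F' = F + (- v) *m p by rewrite mulNmx oF addrK.
have [_ _ /(_ regQ)[wl al]] := weyr_perturb_row lambda weyrP weyrQ eE eF k1.
have [_ _ /(_ regP)[wr ar]] := weyr_perturb_row lambda weyrQ weyrP oE oF k1.
rewrite bP ?bQ // !addn0 in wl al wr ar.
by split; rewrite ?bP ?bQ //; exact: distn_leP.
Qed.
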